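(* Let $A$ be a ring. Let $B$ be an $A$-algebra. Let $x\in B$. Let $m\in\mathbb{N}$ and $n\in\mathbb{N}$. Let $u\in B$. Let $\mu\in\mathbb{N}$ and $\nu\in\mathbb{N}$ be such that $\mu+\nu\in\mathbb{N}^{+}$. Assume that $$u^n\in\left\langle u^0,u^1,\ldots,u^{n-1}\right\rangle_A\cdot\left\langle x^0,x^1,\ldots,x^\nu\right\rangle_A$$ and that $$u^mx^\mu\in\left\langle u^0,u^1,\ldots,u^{m-1}\right\rangle_A\cdot\left\langle x^0,x^1,\ldots,x^\mu\right\rangle_A+\left\langle u^0,u^1,\ldots,u^m\right\rangle_A\cdot\left\langle x^0,x^1,\ldots,x^{\mu-1}\right\rangle_A.$$ Then $u$ is $(n\mu+m\nu)$-integral over $A$.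
   Context: All rings are commutative with unity, and ''$A$-algebra'' means commutative unital $A$-algebra (the structure map $A\to B$ need not be injective). $\mathbb{N}=\{0,1,2,\ldots\}$ and $\mathbb{N}^{+}=\{1,2,3,\ldots\}$. For elements $m_1,\ldots,m_k$ of an $A$-module, $\langle m_1,\ldots,m_k\rangle_A$ denotes their $A$-linear span (the span of an empty list, such as $\langle u^0,\ldots,u^{n-1}\rangle_A$ for $n=0$, is $0$). For $A$-submodules $U,V$ of $B$, $U\cdot V$ denotes the $A$-submodule of $B$ spanned by all products $uv$ with $u\in U$, $v\in V$. For a ring $A$, an $A$-algebra $B$ and $n\in\mathbb{N}$, an element $u\in B$ is called $n$-integral over $A$ if there exists a monic polynomial $P\in A[X]$ with $\deg P=n$ (that is, $P=X^n+\sum_{k=0}^{n-1}a_kX^k$ with $a_k\in A$) and $P(u)=0$. *)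

(* Defs.v *)
From HB Require Import structures.
From mathcomp Require Import all_boot all_order all_algebra.

Set Implicit Arguments.
Unset Strict Implicit.
Unset Printing Implicit Defensive.

Import GRing.Theory.
Local Open Scope ring_scope.

(* An A-algebra B is given by its structure morphism f : A -> B. The "Pz" ring
   structures are used because the zero ring is allowed both for A and for B,
   which rules out comAlgType. A-submodules of B are predicates B -> Prop. *)

Definition lin_span (A B : comPzRingType) (f : {rmorphism A -> B})
    (S : B -> Prop) : B -> Prop :=
  fun b => exists (k : nat) (a : 'I_k -> A) (v : 'I_k -> B),
    (forall i, S (v i)) /\ b = \sum_(i < k) f (a i) * v i.

(* <y^0, ..., y^(n-1)>_A : n is the number of generators, so that
   <y^0, ..., y^n>_A is pow_span f y n.+1. *)
Definition pow_span (A B : comPzRingType) (f : {rmorphism A -> B})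
    (y : B) (n : nat) : B -> Prop :=
  lin_span f (fun v => exists2 i : nat, (i < n)%N & v = y ^+ i).

Definition submod_mul (A B : comPzRingType) (f : {rmorphism A -> B})
    (U V : B -> Prop) : B -> Prop :=
  lin_span f (fun w => exists p q : B, [/\ U p, V q & w = p * q]).

Definition submod_add (B : comPzRingType) (U V : B -> Prop) : B -> Prop :=
  fun w => exists p q : B, [/\ U p, V q & w = p + q].

(* The monic polynomial X^n + \sum_(k < n) a_k X^k is given by its lower
   coefficients, since {poly A} does not exist for the zero ring; see
   n_integralP for the agreement with {poly A} over nonzero rings. *)
Definition n_integral (A B : comPzRingType) (f : {rmorphism A -> B})
    (n : nat) (u : B) : Prop :=
  exists a : 'I_n -> A, u ^+ n + \sum_(k < n) f (a k) * u ^+ k = 0.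

Lemma n_integralP (A B : comNzRingType) (f : {rmorphism A -> B})
    (n : nat) (u : B) :
  n_integral f n u <->
  exists p : {poly A}, [/\ p \is monic, size p = n.+1 & root (map_poly f p) u].
Proof.
have E (p : {poly A}) : p \is monic -> size p = n.+1 ->
    (map_poly f p).[u] = u ^+ n + \sum_(k < n) f p`_k * u ^+ k.
  move=> /monicP lp sp.
  rewrite (@horner_coef_wide _ n.+1) ?size_map_poly ?sp //; last first.
    by rewrite -sp size_poly.
  rewrite big_ord_recr /= addrC coef_map /=.
  have -> : p`_n = 1 by rewrite -lp /lead_coef sp.
  rewrite rmorph1 mul1r; congr (_ + _); apply: eq_bigr => i _.
  by rewrite coef_map.
split=> [[a ha] | [p [mp sp /rootP pu]]]; last first.
  by exists (fun k => p`_k); rewrite -E.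
pose q : {poly A} := \poly_(i < n) oapp a 0 (insub i).
have sq : (size q < size ('X^n : {poly A}))%N.
  by rewrite size_polyXn ltnS size_poly.
have sp : size ('X^n + q) = n.+1 by rewrite size_polyDl // size_polyXn.
have mp : 'X^n + q \is monic.
  by apply/monicP; rewrite lead_coefDl // lead_coefXn.
exists ('X^n + q); split=> //; apply/rootP; rewrite E //.
rewrite -[RHS]ha; congr (_ + _); apply: eq_bigr => i _.
rewrite coefD coefXn coef_poly ltn_ord (ltn_eqF (ltn_ord i)) add0r.
by rewrite valK.
Qed.

(* Main.v *)
Require Import Defs.
From HB Require Import structures.
From mathcomp Require Import all_boot all_order all_algebra.

Set Implicit Arguments.
Unset Strict Implicit.
Unset Printing Implicit Defensive.

Import GRing.Theory.
Local Open Scope ring_scope.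

(** It suffices to find an A-submodule W of B that contains 1, is stable under
    multiplication by u and is spanned by n * mu + m * nu elements: writing u
    times each generator in terms of the generators gives a square matrix M
    over A, and the Cayley-Hamilton argument shows that the characteristic
    polynomial of M, evaluated at u, kills W, hence kills 1
    ([n_integral_of_stable]).

    Here W is spanned by the monomials u^i x^j with (i, j) in the L-shaped
    region consisting of the two rectangles [0, n) x [0, mu) and
    [0, m) x [mu, mu + nu).  Both properties of W follow from one claim: every
    monomial u^c x^d with d < mu + nu, whatever c is, lies in W
    ([monomial_in_staircase]).  A monomial outside the region can be rewritten
    by one of the two hypotheses: by the first if d < mu (then c >= n), by the
    second if d >= mu (then c >= m).  The first lowers the exponent of u and
    raises that of x by at most nu, so that it stays below mu + nu; the second
    lowers one of the two exponents and does not raise the other.  Thus the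
    pair (c, d) decreases lexicographically and the rewriting terminates.  The
    condition mu + nu > 0 puts 1 = u^0 x^0 in W. *)

(** * Integrality from a stable finitely generated submodule *)

(** This is the case in which characteristic polynomials are available: if E
    is the matrix u - M over B, then E annihilates the column of generators,
    so that multiplying by the adjugate of E makes det E annihilate every
    generator, and therefore 1. *)
Lemma n_integral_of_stable_nz (A B : comNzRingType) (f : {rmorphism A -> B})
    (N : nat) (w : 'I_N -> B) (u : B) :
  (forall i, exists c : 'I_N -> A, u * w i = \sum_j f (c j) * w j) ->
  (exists c : 'I_N -> A, 1 = \sum_j f (c j) * w j) ->
  n_integral f N u.
Proof.
move=> /(@fin_all_exists _ (fun=> 'I_N -> A)) [c uw] [d one_w].
pose M : 'M[A]_N := \matrix_(i, j) c i j.
pose E : 'M[B]_N := u%:M - map_mx f M.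
pose W : 'cV[B]_N := \col_i w i.
have EW : E *m W = 0.
  apply/colP=> i; rewrite mulmxBl mul_scalar_mx !mxE uw.
  by apply/eqP; rewrite subr_eq0; apply/eqP/eq_bigr => j _; rewrite !mxE.
have detw j : \det E * w j = 0.
  have /colP/(_ j) : (\det E)%:M *m W = 0.
    by rewrite -mul_adj_mx -mulmxA EW mulmx0.
  by rewrite mul_scalar_mx !mxE.
have det0 : \det E = 0.
  rewrite -[LHS]mulr1 one_w mulr_sumr big1 // => j _.
  by rewrite mulrCA detw mulr0.
apply/n_integralP; exists (char_poly M); split.
- exact: char_poly_monic.
- exact: size_char_poly.
apply/rootP; rewrite map_char_poly -horner_evalE -det_map_mx -[RHS]det0.
congr (\det _); apply/matrixP=> i j.
by rewrite !mxE rmorphB rmorphMn /= !horner_evalE hornerX hornerC.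
Qed.

(** If B is the zero ring, every polynomial vanishes at u; otherwise A is not
    the zero ring either, and both can be equipped with the structure of a
    nonzero ring. *)
Lemma n_integral_of_stable (A B : comPzRingType) (f : {rmorphism A -> B})
    (N : nat) (w : 'I_N -> B) (u : B) :
  (forall i, exists c : 'I_N -> A, u * w i = \sum_j f (c j) * w j) ->
  (exists c : 'I_N -> A, 1 = \sum_j f (c j) * w j) ->
  n_integral f N u.
Proof.
have [B0|B1] := eqVneq (1 : B) 0.
  by move=> _ _; exists (fun=> 0); rewrite -[LHS]mul1r B0 mul0r.
have A1 : (1 : A) != 0.
  by apply: contraNneq B1 => A0; rewrite -(rmorph1 f) A0 rmorph0.
pose A' : comNzRingType := HB.pack (A : Type)
  (GRing.ComPzRing.class A) (GRing.PzSemiRing_isNonZero.Build A A1).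
pose B' : comNzRingType := HB.pack (B : Type)
  (GRing.ComPzRing.class B) (GRing.PzSemiRing_isNonZero.Build B B1).
exact: (@n_integral_of_stable_nz A' B' f N w u).
Qed.

(** * Submodules and spans *)

Definition is_submodule (A B : comPzRingType) (f : {rmorphism A -> B})
    (W : B -> Prop) : Prop :=
  [/\ W 0, forall p q, W p -> W q -> W (p + q)
    & forall a p, W p -> W (f a * p)].

Lemma submodule_preim (A B : comPzRingType) (f : {rmorphism A -> B})
    (W : B -> Prop) (t : B) :
  is_submodule f W -> is_submodule f (fun b => W (t * b)).
Proof.
move=> [W0 WD WZ]; split=> [|p q Wp Wq|a p Wp]; first by rewrite mulr0.
- by rewrite mulrDr; apply: WD.
- by rewrite mulrCA; apply: WZ.
Qed.

Lemma lin_span_min (A B : comPzRingType) (f : {rmorphism A -> B})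
    (S W : B -> Prop) (b : B) :
  is_submodule f W -> (forall v, S v -> W v) -> lin_span f S b -> W b.
Proof.
move=> [W0 WD WZ] SW [k [a [v [Sv ->]]]].
by apply: (big_ind W) => // i _; apply/WZ/SW/Sv.
Qed.

Lemma pow_span_mul_min (A B : comPzRingType) (f : {rmorphism A -> B})
    (u x : B) (n k : nat) (W : B -> Prop) (b : B) :
  is_submodule f W ->
  (forall i j, (i < n)%N -> (j < k)%N -> W (u ^+ i * x ^+ j)) ->
  submod_mul f (pow_span f u n) (pow_span f x k) b -> W b.
Proof.
move=> subW monW; apply: lin_span_min => // _ [p [q [pU qV ->]]].
apply: (lin_span_min (W := fun b => W (p * b))) qV; first exact: submodule_preim.
move=> _ [j ltjk ->]; rewrite mulrC.
apply: (lin_span_min (W := fun b => W (x ^+ j * b))) pU; first exact: submodule_preim.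
by move=> _ [i ltin ->]; rewrite mulrC; apply: monW.
Qed.

Definition fam_span (A B : comPzRingType) (f : {rmorphism A -> B})
    (I : finType) (w : I -> B) : B -> Prop :=
  fun b => exists c : I -> A, b = \sum_i f (c i) * w i.

Lemma fam_span_submodule (A B : comPzRingType) (f : {rmorphism A -> B})
    (I : finType) (w : I -> B) : is_submodule f (fam_span f w).
Proof.
split=> [|_ _ [c ->] [d ->]|a _ [c ->]].
- by exists (fun=> 0); rewrite big1 // => i _; rewrite rmorph0 mul0r.
- exists (fun i => c i + d i); rewrite -big_split /=.
  by apply: eq_bigr => i _; rewrite rmorphD mulrDl.
- exists (fun i => a * c i); rewrite mulr_sumr.
  by apply: eq_bigr => i _; rewrite rmorphM mulrA.
Qed.

Lemma fam_span_gen (A B : comPzRingType) (f : {rmorphism A -> B})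
    (I : finType) (w : I -> B) (i : I) : fam_span f w (w i).
Proof.
exists (fun j => (j == i)%:R); rewrite (bigD1 i) //= eqxx rmorph1 mul1r.
by rewrite big1 ?addr0 // => j /negPf->; rewrite rmorph0 mul0r.
Qed.

Lemma n_integral_fam_span (A B : comPzRingType) (f : {rmorphism A -> B})
    (I : finType) (w : I -> B) (u : B) :
  (forall i, fam_span f w (u * w i)) -> fam_span f w 1 ->
  n_integral f #|I| u.
Proof.
have reindexI (c : I -> A) :
    \sum_i f (c i) * w i = \sum_(j < #|I|) f (c (enum_val j)) * w (enum_val j).
  by rewrite (reindex_onto enum_val enum_rank) => [|i _];
     [apply: eq_bigl => j; rewrite enum_valK eqxx | rewrite enum_rankK].
move=> uW oneW; apply: (@n_integral_of_stable _ _ _ _ (w \o enum_val)).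
- move=> i; have [c ->] := uW (enum_val i).
  by exists (c \o enum_val); rewrite reindexI.
- by have [c ->] := oneW; exists (c \o enum_val); rewrite reindexI.
Qed.

(** * The L-shaped family of monomials *)

Section Staircase.

Variables (B : comPzRingType) (x u : B) (m n mu nu : nat).

(** The left summand indexes the rectangle [0, n) x [0, mu) and the right one
    the rectangle [0, m) x [mu, mu + nu).  The sum type keeps the count
    n * mu + m * nu even if some of the monomials coincide in B. *)
Definition staircase_index : finType :=
  (('I_n * 'I_mu) + ('I_m * 'I_nu))%type.

Definition staircase_monomial (k : staircase_index) : B :=
  match k with
  | inl (i, j) => u ^+ i * x ^+ j
  | inr (i, j) => u ^+ i * x ^+ (mu + j)
  end.

Lemma card_staircase_index : #|staircase_index| = (n * mu + m * nu)%N.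
Proof. by rewrite card_sum !card_prod !card_ord. Qed.

Variables (A : comPzRingType) (f : {rmorphism A -> B}).

Let W := fam_span f staircase_monomial.

Hypothesis hn : submod_mul f (pow_span f u n) (pow_span f x nu.+1) (u ^+ n).
Hypothesis hm : submod_add
  (submod_mul f (pow_span f u m) (pow_span f x mu.+1))
  (submod_mul f (pow_span f u m.+1) (pow_span f x mu))
  (u ^+ m * x ^+ mu).

(** The nested strong inductions, on c and inside it on d, are the termination
    argument for the rewriting: [hn] lowers c and may raise d, while [hm]
    lowers c, or keeps c and lowers d. *)
Lemma monomial_in_staircase (c d : nat) :
  (d < mu + nu)%N -> W (u ^+ c * x ^+ d).
Proof.
have subW : is_submodule f W by apply: fam_span_submodule.
elim/ltn_ind: c d => c IHc; elim/ltn_ind=> d IHd ltd.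
have [ltdmu|lemud] := ltnP d mu.
  have [ltcn|lenc] := ltnP c n.
    exact: (fam_span_gen f _ (inl (Ordinal ltcn, Ordinal ltdmu))).
  rewrite -(subnK lenc) exprD mulrAC.
  apply: (pow_span_mul_min (W := fun b => W (u ^+ (c - n) * x ^+ d * b))) hn.
    exact: submodule_preim.
  move=> i j ltin lejnu; rewrite mulrACA -!exprD; apply: IHc.
    by rewrite -[ltnRHS](subnK lenc) ltn_add2l.
  by rewrite -addSn leq_add.
have ltd_nu : (d - mu < nu)%N by rewrite ltn_subLR.
have [ltcm|lemc] := ltnP c m.
  have := fam_span_gen f staircase_monomial
    (inr (Ordinal ltcm, Ordinal ltd_nu)).
  by rewrite /= subnKC.
rewrite -(subnK lemc) -(subnK lemud) 2!exprD mulrACA.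
set t := u ^+ (c - m) * x ^+ (d - mu).
have [p [q [hp hq ->]]] := hm; rewrite mulrDr.
case: (subW) => _ WD _; apply: WD.
- apply: (pow_span_mul_min (W := fun b => W (t * b))) hp.
    exact: submodule_preim.
  move=> i j ltim lejmu; rewrite mulrACA -!exprD; apply: IHc.
    by rewrite -[ltnRHS](subnK lemc) ltn_add2l.
  by apply: leq_ltn_trans ltd; rewrite -[leqRHS](subnK lemud) leq_add2l.
- apply: (pow_span_mul_min (W := fun b => W (t * b))) hq.
    exact: submodule_preim.
  move=> i j leim ltjmu; rewrite mulrACA -!exprD.
  have ltd2 : (d - mu + j < d)%N.
    by rewrite -[ltnRHS](subnK lemud) ltn_add2l.
  move: leim; rewrite ltnS leq_eqVlt => /orP[/eqP->|ltim].
    by rewrite subnK //; apply: IHd => //; apply: ltn_trans ltd.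
  apply: IHc; last exact: ltn_trans ltd.
  by rewrite -[ltnRHS](subnK lemc) ltn_add2l.
Qed.

End Staircase.

Theorem lemma5p1 (A B : comPzRingType) (f : {rmorphism A -> B})
    (x : B) (m n : nat) (u : B) (mu nu : nat) (hmunu : (0 < mu + nu)%N)
    (hn : submod_mul f (pow_span f u n) (pow_span f x nu.+1) (u ^+ n))
    (hm : submod_add
            (submod_mul f (pow_span f u m) (pow_span f x mu.+1))
            (submod_mul f (pow_span f u m.+1) (pow_span f x mu))
            (u ^+ m * x ^+ mu)) :
  n_integral f (n * mu + m * nu)%N u.
Proof.
rewrite -(card_staircase_index m n mu nu).
apply: (n_integral_fam_span
  (w := @staircase_monomial B x u m n mu nu)).
- case=> -[i j] /=; rewrite mulrA -exprS.
  + by apply: monomial_in_staircase => //; apply: ltn_addr.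
  + by apply: monomial_in_staircase => //; rewrite ltn_add2l.
- have := monomial_in_staircase hn hm 0 hmunu.
  by rewrite !expr0 mul1r.
Qed.
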